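(* Let $(\Omega,\mathcal{F})$ be a standard Borel space, and let $E$ be an equivalence relation on $\Omega$ that can be written as $E=\bigcup_{n\in\mathbb{N}}E_n$ for some smooth equivalence relations $E_1\subseteq E_2\subseteq\cdots$ on $\Omega$. Then $E$ is strongly dualizable.
   Context: An equivalence relation $E$ on a standard Borel space $(\Omega,\mathcal{F})$ is smooth if there exist a standard Borel space $(X,\mathcal{X})$ and a measurable map $\phi:(\Omega,\mathcal{F})\to(X,\mathcal{X})$ such that for all $\omega,\omega'\in\Omega$: $(\omega,\omega')\in E$ if and only if $\phi(\omega)=\phi(\omega')$. Define $E^{\ast}:=\{A\in\mathcal{F}:\forall(\omega,\omega')\in E,\ (\omega\in A\Leftrightarrow\omega'\in A)\}$. $\mathcal{P}(\Omega,\mathcal{F})$ is the set of probability measures on $(\Omega,\mathcal{F})$, and $\Pi(\mathbb{P},\mathbb{P}')$ is the set of probability measures on $(\Omega\times\Omega,\mathcal{F}\otimes\mathcal{F})$ with marginals $\mathbb{P}$ and $\mathbb{P}'$. A pair $(E,\mathcal{G})$, with $\mathcal{G}$ a sub-$\sigma$-algebra of $\mathcal{F}$, satisfies strong duality if $E\in\mathcal{F}\otimes\mathcal{F}$ and, for all $\mathbb{P},\mathbb{P}'\in\mathcal{P}(\Omega,\mathcal{F})$, $$\max_{A\in\mathcal{G}}|\mathbb{P}(A)-\mathbb{P}'(A)|=\min_{\tilde{\mathbb{P}}\in\Pi(\mathbb{P},\mathbb{P}')}(1-\tilde{\mathbb{P}}(E)),$$ where max and min assert that the supremum and infimum are both attained.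 An equivalence relation $E$ is strongly dualizable if the pair $(E,E^{\ast})$ satisfies strong duality. *)

(* Defs.v *)
From HB Require Import structures.
From mathcomp Require Import all_boot all_order all_algebra.
From mathcomp Require Import all_classical all_reals all_analysis.

Set Implicit Arguments.
Unset Strict Implicit.
Unset Printing Implicit Defensive.

Import Order.TTheory GRing.Theory Num.Theory.
Local Open Scope classical_set_scope.
Local Open Scope ereal_scope.

#[short(type="completeMetricType")]
HB.structure Definition CompleteMetric (K : numDomainType) :=
  { M of CompletePseudoMetric K M & PseudoMetric_isMetric K M }.

Definition separable (X : topologicalType) : Prop :=
  exists2 D : set X, countable D & dense D.

(* Isomorphic, as a measurable space, to a Polish space X with its Borel
   sigma-algebra <<s open >>. The metric takes its values in R, which is
   harmless since all realTypes are isomorphic. *)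
Definition standard_borel (R : realType) (d : measure_display)
    (T : measurableType d) : Prop :=
  exists X : completeMetricType R, separable X /\
  exists (f : T -> X) (g : X -> T),
    [/\ cancel f g, cancel g f,
        forall B : set X, <<s @open X >> B -> measurable (f @^-1` B) &
        forall A : set T, measurable A -> <<s @open X >> (g @^-1` A)].

Definition equivalence (T : Type) (E : set (T * T)) : Prop :=
  [/\ forall x, E (x, x),
      forall x y, E (x, y) -> E (y, x) &
      forall x y z, E (x, y) -> E (y, z) -> E (x, z)].

Definition smooth (R : realType) (d : measure_display) (T : measurableType d)
    (E : set (T * T)) : Prop :=
  exists (d' : measure_display) (X : measurableType d') (phi : T -> X),
    [/\ standard_borel R X, measurable_fun [set: T] phi &
        forall w w' : T, E (w, w') <-> phi w = phi w'].

Record subSigmaAlgebra (d : measure_display) (T : measurableType d) :=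
  SubSigmaAlgebra {
    sub_sets :> set (set T) ;
    sub_sigma_algebra : sigma_algebra [set: T] sub_sets ;
    sub_measurable : sub_sets `<=` measurable }.

Definition invariant_sets (d : measure_display) (T : measurableType d)
    (E : set (T * T)) : set (set T) :=
  [set A | measurable A /\ forall w w' : T, E (w, w') -> (A w <-> A w')].

Lemma invariant_sigma_algebra (d : measure_display) (T : measurableType d)
  (E : set (T * T)) : sigma_algebra [set: T] (invariant_sets E).
Proof.
split => [|A [mA EA]|F EF]; split.
- exact: measurable0.
- by [].
- by rewrite setTD; exact: measurableC.
- by move=> w w' /EA; rewrite /setD/=; tauto.
- by apply: bigcup_measurable => k _; case: (EF k).
- move=> w w' Eww'; split => -[k _ Fk]; exists k => //.
  + exact/((EF k).2 _ _ Eww').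
  + exact/((EF k).2 _ _ Eww').
Qed.

Lemma invariant_measurable (d : measure_display) (T : measurableType d)
  (E : set (T * T)) : invariant_sets E `<=` measurable.
Proof. by move=> A []. Qed.

(* The sigma-algebra usually denoted E^*. *)
Definition invariant_algebra (d : measure_display) (T : measurableType d)
    (E : set (T * T)) : subSigmaAlgebra T :=
  SubSigmaAlgebra (invariant_sigma_algebra E) (@invariant_measurable d T E).

Definition couplings (R : realType) (d : measure_display)
    (T : measurableType d) (P P' : probability T R) :
    set (probability (T * T)%type R) :=
  [set Q | forall A : set T, measurable A ->
     Q (fst @^-1` A) = P A /\ Q (snd @^-1` A) = P' A].

Definition is_max (R : realType) (S : set (\bar R)) (m : \bar R) : Prop :=
  S m /\ ubound S m.

Definition is_min (R : realType) (S : set (\bar R)) (m : \bar R) : Prop :=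
  S m /\ lbound S m.

Definition strong_duality (R : realType) (d : measure_display)
    (T : measurableType d) (E : set (T * T)) (G : subSigmaAlgebra T) : Prop :=
  measurable E /\
  forall P P' : probability T R, exists m : \bar R,
    is_max [set `|P A - P' A| | A in sub_sets G] m /\
    is_min [set 1 - Q E | Q in couplings P P'] m.

Definition strongly_dualizable (R : realType) (d : measure_display)
    (T : measurableType d) (E : set (T * T)) : Prop :=
  strong_duality R E (invariant_algebra E).

(* Main.v *)
Require Import Defs.
From HB Require Import structures.
From mathcomp Require Import all_boot all_order all_algebra.
From mathcomp Require Import all_classical all_reals all_analysis.
From mathcomp Require Import lra.
Import numFieldNormedType.Exports.

(* Greedy coupling. For a single smooth relation E, given by a measurable map
   phi, there are a coupling r of a part of mu with a part of nu that lives on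
   E, and an E-invariant set A (the positive part of the Hahn decomposition of
   phi_* mu - phi_* nu) such that the uncoupled rest of mu lives on A and the
   uncoupled rest of nu lives on the complement of A. Apply this to P and P'
   with E_0, then to the rests with E_1, and so on. The final rests are
   dominated by all the intermediate ones, so they are separated by
   A = liminf A_n, which is invariant under each E_k because A_n is as soon as
   k <= n. Coupling the final rests arbitrarily yields a coupling Q with
   1 - Q E <= P A - P' A.

   For one smooth E no disintegration is needed. The relation phi x = phi y is
   the decreasing limit of the relations "phi x and phi y are in the same cell"
   for refining finite partitions into cells, and for a finite partition the
   optimal coupling is a sum of weighted product measures. The values of these
   couplings on rectangles have a limit along an ultrafilter, which is only
   finitely additive, but tightness and regularity of the marginals make it
   countably additive. *)

Set Implicit Arguments.
Unset Strict Implicit.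
Unset Printing Implicit Defensive.

Import Order.TTheory GRing.Theory Num.Theory.
Local Open Scope classical_set_scope.
Local Open Scope ring_scope.
Local Open Scope ereal_scope.

(** * Tightness and regularity on Polish spaces *)

Section finite_measure_approximation.
Context (R : realType) (d : measure_display) (T : measurableType d).
Implicit Types (mu : {finite_measure set T -> \bar R}) (e : R).

Lemma measure_bigcup_le_geometric (mu : {measure set T -> \bar R}) e
    (F : nat -> set T) :
  (0 <= e)%R -> (forall n, measurable (F n)) ->
  (forall n, mu (F n) <= (e / (2 ^ n.+1)%:R)%:E) ->
  mu (\bigcup_n F n) <= e%:E.
Proof.
move=> e0 mF Fe.
have mUF : measurable (\bigcup_n F n) by exact: bigcupT_measurable.
apply: (le_trans (generalized_Boole_inequality mu mF mUF)).
have := @epsilon_trick R (fun=> 0) e predT (fun=> lexx 0) e0.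
rewrite [X in _ <= X + _]eseries0// add0e; apply: le_trans.
by apply: lee_nneseries => // n _; rewrite add0e.
Qed.

(** Continuity from above along the differences with [F n], which decrease to the empty set; this
    uses that [mu] is finite. *)
Lemma nondecreasing_measure_approx mu (F : nat -> set T) e :
  (0 < e)%R -> (forall n, measurable (F n)) ->
  {homo F : n m / (n <= m)%N >-> (n <= m)%O} ->
  exists n, mu (\bigcup_n F n `\` F n) <= e%:E.
Proof.
move=> e0 mF ndF; set A := \bigcup_n F n.
have mA : measurable A by exact: bigcupT_measurable.
have mAF n : measurable (A `\` F n) by exact: measurableD.
have AF0 : \bigcap_n (A `\` F n) = set0.
  by rewrite -subset0 => x AFx; have [[n _ Fnx] _] := AFx 0%N I; case: (AFx n I).
have := @nonincreasing_cvg_mu _ _ _ mu (fun n => A `\` F n).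
rewrite AF0 measure0 => /(_ _ mAF measurable0)/= cvgAF.
have : (mu \o (fun n => A `\` F n)) x @[x --> \oo] --> 0.
  apply: cvgAF.
    by rewrite -ge0_fin_numE// fin_num_measure.
  move=> n m nm; apply/subsetPset => x [Ax Fnx]; split => // Fx; apply: Fnx.
  exact: (subsetPset _ _ (ndF _ _ nm)).
move/fine_cvgP => -[_ /cvgrPdist_le/(_ _ e0)[n _ /(_ n (leqnn n))/=]].
rewrite sub0r normrN ger0_norm ?fine_ge0// => Fe; exists n.
by rewrite -(@fineK _ (mu _)) ?fin_num_measure// lee_fin.
Qed.

End finite_measure_approximation.

(** Interiors of balls are used so that the covering sets are open, hence Borel. *)
Lemma separable_dense_seq (R : realType) (X : completeMetricType R) :
  separable X -> exists x : nat -> X,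
    forall (y : X) (e : R), (0 < e)%R -> exists i, (ball (x i) e)° y.
Proof.
move=> [D cD dD].
have [D0|[f]] := pfcard_geP cD.
  have [|z [_]] := dD setT _ openT; first by exists point.
  by rewrite D0.
exists f => y e e0.
have e20 : (0 < e / 2)%R by rewrite divr_gt0.
have oy := open_nbhs_ball y (PosNum e20).
have [|z [/interior_subset yz Dz]] := dD _ _ oy.1.
  by exists y; exact: nbhs_singleton (open_nbhs_nbhs oy).
have [n _ fn] := @surj _ _ _ _ f z Dz.
exists n; rewrite fn; apply: filterS (nbhsx_ballx y _ e20) => w yw.
by rewrite [e]splitr; apply: ball_triangle yw; exact: ball_sym.
Qed.

(** The factor 2 leaves room for a triangle inequality through a common centre, or for taking the
    closure of a ball. *)
Lemma sub_ball_invn (R : realType) (X : completeMetricType R) (e : R) :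
  (0 < e)%R -> exists n, forall x : X, ball x (2 * n.+1%:R^-1)%R `<=` ball x e.
Proof.
move=> e0; exists (Num.truncn (2 / e)) => x; apply: le_ball.
set N := Num.truncn _.
have N1 : (2 / e < N.+1%:R)%R by exact: truncnS_gt.
rewrite ler_pdivrMr// mulrC -ler_pdivrMr//; exact: ltW.
Qed.

(** Countably many small balls about the points of a dense sequence separate the points of a metric
    space. *)
Lemma standard_borel_separating (R : realType) (d : measure_display)
    (T : measurableType d) :
  standard_borel R T -> exists B : nat -> set T,
    (forall n, measurable (B n)) /\
    forall x y, (forall n, B n x <-> B n y) -> x = y.
Proof.
move=> [X [sX [f [g [fK gK mf mg]]]]].
have [x xP] := separable_dense_seq sX.
pose O (p : nat * nat) := interior (ball (x p.1) p.2.+1%:R^-1%R).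
(* Numbers that encode no pair get the default [(0, 0)], which only repeats one of the sets. *)
exists (fun n => f @^-1` O (odflt (0, 0)%N (unpickle n))); split.
  by move=> n; apply: mf; apply: sub_sigma_algebra; exact: open_interior.
move=> y z yz; rewrite -(fK y) -(fK z); congr g.
have {}yz p : O p (f y) -> O p (f z).
  by have := yz (pickle p); rewrite pickleK /= => -[].
apply/eqP; apply: contrapT => /negP yNz.
have e0 : (0 < mdist (f y) (f z))%R by rewrite mdist_gt0.
have [n nP] := sub_ball_invn X e0.
have [i Oi] := xP (f y) n.+1%:R^-1%R (ltac:(by rewrite invr_gt0)).
have /interior_subset := yz (i, n) Oi.
move: Oi => /interior_subset/ball_sym/ball_triangle h/h.
rewrite /= -mulr2n -[X in ball _ X]mulr_natl => fyz.
by have := nP _ _ fyz; rewrite ballEmdist/= ltxx.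
Qed.

Lemma ultra_bigcup_ord (T : Type) (G : set_system T) (C : nat -> set T) N :
  UltraFilter G -> G (\bigcup_(i < N) C i) -> exists i, G (C i).
Proof.
move=> UG; elim: N => [|N IH].
  by rewrite II0 bigcup0// => /filter_ex[].
rewrite bigcup_mkord big_ord_recr/= => GC.
have [GN|GN] := in_ultra_setVsetC (C N) UG; first by exists N.
apply: IH; rewrite bigcup_mkord; apply: filterS (filterI GC GN).
by move=> t [[]].
Qed.

Section tightness_and_regularity.
Context (R : realType) (d : measure_display) (T : measurableType d).
Context (X : completeMetricType R) (f : T -> X).
Hypothesis mf : forall B : set X, <<s @open X >> B -> measurable (f @^-1` B).
Implicit Types (mu : {finite_measure set T -> \bar R}) (e : R).

Let mopen (U : set X) : open U -> measurable (f @^-1` U).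
Proof. by move=> oU; apply: mf; exact: sub_sigma_algebra. Qed.

Let mclosed (F : set X) : closed F -> measurable (f @^-1` F).
Proof.
move=> cF; rewrite (_ : f @^-1` F = ~` (f @^-1` ~` F)).
  by apply: measurableC; exact/mopen/closed_openC.
by rewrite preimage_setC setCK.
Qed.

Let mpreD (A B : set X) : measurable (f @^-1` A) -> measurable (f @^-1` B) ->
  measurable (f @^-1` (A `\` B)).
Proof. exact: measurableD. Qed.

(** Ulam's theorem. At scale [n], finitely many closed balls carry all the mass up to
    [e / 2 ^ n.+1]; the intersection over all scales is closed and totally bounded, hence compact by
    completeness. *)
Lemma tight_finite_measure mu e : separable X -> (0 < e)%R ->
  exists2 K : set X, compact K /\ closed K & mu (f @^-1` ~` K) <= e%:E.
Proof.
move=> sX e0; have [x xP] := separable_dense_seq sX.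
pose C n i := closure (ball (x i) n.+1%:R^-1%R).
pose F n N := \bigcup_(i < N) C n i.
have cF n N : closed (F n N).
  by apply: closed_bigcup => [|i _]; [exact: finite_II|exact: closed_closure].
have FT n : \bigcup_N f @^-1` F n N = setT.
  apply/seteqP; split => // t _.
  have [i /interior_subset ti] := xP (f t) n.+1%:R^-1%R (ltac:(by rewrite invr_gt0)).
  by exists i.+1 => //; exists i => //=; exact: subset_closure.
have /choice[N NP] n : exists N, mu (~` (f @^-1` F n N)) <= (e / (2 ^ n.+1)%:R)%:E.
  have en0 : (0 < e / (2 ^ n.+1)%:R)%R by rewrite divr_gt0// ltr0n expn_gt0.
  have [||N] := @nondecreasing_measure_approx _ _ _ mu (fun N => f @^-1` F n N) _ en0.
  - by move=> N; exact: mclosed.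
  - move=> N M NM; apply/subsetPset => t [i iN Ci]; exists i => //=.
    exact: leq_trans NM.
  - by rewrite FT setTD; exists N.
exists (\bigcap_n F n (N n)); last first.
  rewrite setC_bigcap preimage_bigcup.
  apply: measure_bigcup_le_geometric => [|n|n]; [exact: ltW| |exact: NP].
  exact/mopen/closed_openC.
have cK : closed (\bigcap_n F n (N n)) by apply: closed_bigI => m _.
split => //; rewrite compact_ultra => G UG GK.
suff cG : cvg G by exists (lim G); split => //; exact: (@closed_cvg _ _ G _ id _ cK).
apply: cauchy_cvg; apply/cauchyP => r r0.
have [n nP] := sub_ball_invn X r0.
(* An ultrafilter on a finite union of small balls contains one of them, so [G] is Cauchy. *)
have [i Gi] : exists i, G (C n i).
  by apply: (ultra_bigcup_ord (N := N n)); apply: filterS GK => t; exact.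
exists (x i); apply: filterS Gi => t.
have n0 : (0 < 2 * n.+1%:R^-1 :> R)%R by rewrite mulr_gt0.
have := subset_closure_half n0 (x := x i).
by rewrite /closed_ball mulrC mulKf// => h /h; exact: nP.
Qed.

(** Approximation from both sides makes the class stable under complements: the two approximating
    sets are complemented and exchanged. *)
Definition regular_sets (mu : {finite_measure set T -> \bar R}) : set (set X) :=
  [set B | measurable (f @^-1` B) /\ forall e : R, (0 < e)%R ->
    exists F U, [/\ closed F, open U, F `<=` B, B `<=` U &
      mu (f @^-1` (U `\` F)) <= e%:E]].

(** An open set is the increasing union of the closed sets [F n] of points lying in no open ball of
    radius [1 / n.+1] centred outside [G]. *)
Lemma open_regular mu (G : set X) : open G -> regular_sets mu G.
Proof.
move=> oG; split; first exact: mopen.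
move=> e e0.
pose F (n : nat) := ~` \bigcup_(y in ~` G) (ball y n.+1%:R^-1%R)°.
have cF n : closed (F n).
  by apply: open_closedC; apply: bigcup_open => y _; exact: open_interior.
have FG n : F n `<=` G.
  move=> y Fy; apply: contrapT => Gy; apply: Fy; exists y => //.
  by apply: nbhsx_ballx; rewrite invr_gt0.
have UF : \bigcup_n (f @^-1` F n) = f @^-1` G.
  apply/seteqP; split => [t [n _ /FG]//|t Gt].
  have /nbhs_ballP[r /= r0 rG] : nbhs (f t) G by exact: open_nbhs_nbhs.
  have [n nP] := sub_ball_invn X r0.
  exists n => // -[y Gy /interior_subset ty]; apply/Gy/rG/nP.
  apply: ball_sym; apply: le_ball ty.
  by rewrite ler_peMl// ?invr_ge0// ler1n.
have [||n] := @nondecreasing_measure_approx _ _ _ mu (fun n => f @^-1` F n) _ e0.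
- by move=> n; exact: mclosed.
- move=> n m nm; apply/subsetPset => t; apply: subsetC => y [z Gz yz].
  exists z => //; move: yz; apply: interiorS; apply: le_ball.
  by rewrite lef_pV2 ?posrE// ler_nat.
- by rewrite UF => Fe; exists (F n), G; split => //; exact: FG.
Qed.

(** For a countable union, all the outer open sets are united, but only finitely many inner closed
    ones, to remain closed. Half of [e] pays for this truncation and the other half is spread
    geometrically over the individual approximations. *)
Lemma regular_sets_sigma_algebra mu : sigma_algebra [set: X] (regular_sets mu).
Proof.
split.
- exact/open_regular/open0.
- move=> B [mB rB]; rewrite setTD; split.
    by rewrite preimage_setC; exact: measurableC.
  move=> e /rB[F [U [cF oU FB BU UFe]]]; exists (~` U), (~` F); split.
  + exact: open_closedC.
  + exact: closed_openC.
  + exact: subsetC.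
  + exact: subsetC.
  + apply: le_trans UFe; rewrite le_eqVlt; apply/orP; left; apply/eqP.
    by rewrite !setDE setCK setIC.
- move=> B rB; have mUB : measurable (f @^-1` \bigcup_k B k).
    by rewrite preimage_bigcup; apply: bigcupT_measurable => k; exact: (rB k).1.
  split => // e e0.
  have e20 : (0 < e / 2)%R by rewrite divr_gt0.
  have /choice[FU FUP] k : exists p : set X * set X, [/\ closed p.1, open p.2,
      p.1 `<=` B k, B k `<=` p.2 &
      mu (f @^-1` (p.2 `\` p.1)) <= (e / 2 / (2 ^ k.+1)%:R)%:E].
    have [|F [U FU]] := (rB k).2 (e / 2 / (2 ^ k.+1)%:R)%R.
      by rewrite divr_gt0// ltr0n expn_gt0.
    by exists (F, U).
  pose U := \bigcup_k (FU k).2.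
  pose G n := \bigcup_(k < n) (FU k).1.
  have cG n : closed (G n).
    apply: closed_bigcup => [|k _]; first exact: finite_II.
    by have [] := FUP k.
  have [||n] := @nondecreasing_measure_approx _ _ _ mu (fun n => f @^-1` G n) _ e20.
  + by move=> n; exact: mclosed.
  + move=> n m nm; apply/subsetPset => t [k kn Fk]; exists k => //=.
    exact: leq_trans nm.
  set H := \bigcup_n _ => Gne.
  have oU : open U by apply: bigcup_open => k _; have [] := FUP k.
  exists (G n), U; split => //.
  + by move=> y [k _ Fk]; exists k => //; have [_ _ + _ _] := FUP k; exact.
  + by move=> y [k _ Bk]; exists k => //; have [_ _ _ + _] := FUP k; exact.
  have mH : measurable H by apply: bigcupT_measurable => k; exact: mclosed.
  have mD k : measurable (f @^-1` ((FU k).2 `\` (FU k).1)).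
    have [? ? _ _ _] := FUP k.
    by apply: mpreD; [exact: mopen|exact: mclosed].
  have sub : f @^-1` (U `\` G n) `<=`
      \bigcup_k (f @^-1` ((FU k).2 `\` (FU k).1)) `|` (H `\` f @^-1` G n).
    move=> t [[k _ Uk] Gt].
    have [Fk|Fk] := pselect ((FU k).1 (f t)); last by left; exists k.
    by right; split => //; exists k.+1 => //; exists k => /=.
  have mUD := bigcupT_measurable _ mD.
  have mHG : measurable (H `\` f @^-1` G n).
    by apply: measurableD => //; exact: mclosed.
  apply: (@le_trans _ _ (mu (\bigcup_k (f @^-1` ((FU k).2 `\` (FU k).1)) `|`
      (H `\` f @^-1` G n)))).
    apply: le_measure => //; rewrite inE; last exact: measurableU.
    by apply: mpreD; [exact: mopen|exact: mclosed].
  apply: (le_trans (measureU2 _ _ _)) => //.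
  rewrite [e]splitr EFinD; apply: leeD => //.
  apply: measure_bigcup_le_geometric => //; first exact: ltW.
  by move=> k; have [] := FUP k.
Qed.

Lemma outer_regular_finite_measure mu (B : set X) e :
  <<s @open X >> B -> (0 < e)%R ->
  exists U, [/\ open U, B `<=` U & mu (f @^-1` (U `\` B)) <= e%:E].
Proof.
move=> sB e0.
have [mB rB] : regular_sets mu B.
  apply: smallest_sub sB; first exact: regular_sets_sigma_algebra.
  exact: open_regular.
have [F [U [cF oU FB BU UFe]]] := rB e e0.
exists U; split => //; apply: le_trans UFe; apply: le_measure.
- by rewrite inE; apply: mpreD => //; exact: mopen.
- rewrite inE; apply: mpreD; [exact: mopen|exact: mclosed].
- by move=> t [Ut Bt]; split => // /FB.
Qed.

End tightness_and_regularity.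

(** * Differences of finite measures *)

Section finite_measure_of.
Context (R : realType) (d : measure_display) (T : measurableType d).
Variables (mu : {measure set T -> \bar R}) (finmu : mu setT < +oo).

(** The proof of finiteness is a phantom argument, so that the structure of a finite measure can be
    attached to the term. [measure_of_outer], [outer_measure_of_cover] and [probability_of] use the
    same device. *)
Definition finite_measure_of of mu setT < +oo : set T -> \bar R := mu.

HB.instance Definition _ := Measure.on (finite_measure_of finmu).

Let fin : fin_num_fun (finite_measure_of finmu).
Proof. exact: lty_fin_num_fun. Qed.

HB.instance Definition _ :=
  @Measure_isFinite.Build _ _ _ (finite_measure_of finmu) fin.

End finite_measure_of.

Lemma finite_measure_EFin (R : realType) (d : measure_display)
    (T : measurableType d) (mu : {finite_measure set T -> \bar R}) A :
  measurable A -> exists a, mu A = a%:E.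
Proof. by move=> mA; exists (fine (mu A)); rewrite fineK// fin_num_measure. Qed.

Section charge_difference.
Context (R : realType) (d : measure_display) (T : measurableType d).
Implicit Types mu nu : {finite_measure set T -> \bar R}.

Let diff mu nu : {charge set T -> \bar R} :=
  cadd (charge_of_finite_measure mu) (copp (charge_of_finite_measure nu)).

Let diffE mu nu A : diff mu nu A = mu A - nu A.
Proof. by []. Qed.

(** The positive set of a Hahn decomposition of [mu - nu] maximises this difference. Sums on both
    sides avoid subtraction of extended reals. *)
Lemma maximal_difference_set mu nu : exists2 A, measurable A &
  forall B, measurable B -> mu B + nu A <= mu A + nu B.
Proof.
have [P [N [[mP posP] [mN negN] PN PN0]]] := Hahn_decomposition (diff mu nu).
exists P => // B mB.
have NE : N = ~` P.
  apply/seteqP; split => x; first by move=> Nx Px; have : (P `&` N) x by []; rewrite PN0.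
  by move=> Px; have : [set: T] x by []; rewrite -PN => -[].
have mBP : measurable (B `&` P) by exact: measurableI.
have mPB : measurable (P `\` B) by exact: measurableD.
have mBN : measurable (B `\` P) by exact: measurableD.
have BPN : (B `\` P) `<=` N by rewrite NE => x [].
have := posP _ mPB (@subDsetl _ _ _); have := negN _ mBN BPN.
have DI (m : {finite_measure set T -> \bar R}) :
    m B = m (B `\` P) + m (B `&` P) /\ m P = m (P `\` B) + m (B `&` P).
  by split; [|rewrite setIC]; exact: measureDI.
(* After cancelling the common part of [B] and [P], it remains that the difference is at most 0 off
   [P] and at least 0 on [P]. *)
rewrite !diffE (DI mu).1 (DI mu).2 (DI nu).1 (DI nu).2.
have [a ->] := finite_measure_EFin mu mBP.
have [b ->] := finite_measure_EFin mu mPB.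
have [c ->] := finite_measure_EFin mu mBN.
have [a' ->] := finite_measure_EFin nu mBP.
have [b' ->] := finite_measure_EFin nu mPB.
have [c' ->] := finite_measure_EFin nu mBN.
rewrite -!EFinN -!EFinD !lee_fin => {posP negN} h1 h2; lra.
Qed.

Lemma finite_measure_difference mu (nu : {measure set T -> \bar R}) :
  (forall A, measurable A -> nu A <= mu A) ->
  exists rho : {finite_measure set T -> \bar R},
    forall A, measurable A -> mu A = nu A + rho A.
Proof.
move=> numu.
have finnu : nu setT < +oo.
  by apply: le_lt_trans (numu _ measurableT) _; rewrite -ge0_fin_numE// fin_num_measure.
(* [crestr0] is 0 on non-measurable sets, which gives nonnegativity on every set, as
   [measure_of_charge] requires. *)
have rho0 A : 0 <= crestr0 (diff mu (finite_measure_of finnu)) measurableT A.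
  rewrite /crestr0; case: ifPn => // /[!inE] mA.
  rewrite /crestr setIT diffE leeBrDr ?add0e ?numu//.
  exact: (@fin_num_measure _ _ _ (finite_measure_of finnu)).
have finrho : measure_of_charge _ rho0 setT < +oo.
  by rewrite -ge0_fin_numE ?measure_ge0// /measure_of_charge fin_num_measure.
exists (finite_measure_of finrho) => A mA.
have nuA : nu A \is a fin_num := @fin_num_measure _ _ _ (finite_measure_of finnu) A mA.
rewrite /= /finite_measure_of /= /measure_of_charge /= /crestr0 mem_set//.
rewrite /crestr setIT diffE.
by rewrite addeC subeK.
Qed.
End charge_difference.

(** * Optimal couplings for finite partitions *)

Section cells.
Context (d : measure_display) (X : measurableType d) (B : nat -> set X).
Hypothesis mB : forall n, measurable (B n).

(* The binary digits of [j] tell in which of the sets [B 0], ..., [B k.-1] the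
   cell is included. *)
Fixpoint cell (k j : nat) : set X :=
  if k is k'.+1 then cell k' j./2 `&` (if odd j then B k' else ~` B k')
  else if j == 0%N then setT else set0.

Lemma measurable_cell k j : measurable (cell k j).
Proof.
elim: k j => [|k IH] j /=; first by case: ifP.
by apply: measurableI => //; case: ifP => // _; exact: measurableC.
Qed.

Lemma cell_cover k x : exists2 j, (j < 2 ^ k)%N & cell k j x.
Proof.
elim: k => [|k [j jk cj]]; first by exists 0%N.
(* The membership in [B k] is appended as the lowest binary digit. *)
exists (`[< B k x >] + j.*2)%N.
  rewrite expnS mul2n; case: asboolP => _; rewrite ?add1n ?add0n.
    by rewrite ltn_Sdouble.
  by rewrite ltn_double.
rewrite /= half_bit_double oddD odd_double addbF oddb; split => //.
by case: asboolP.
Qed.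

Lemma cell_inj k i j x : cell k i x -> cell k j x -> i = j.
Proof.
elim: k i j => [|k IH] i j /=.
  by case: eqP => [->|_]//; case: eqP.
move=> [ci Bi] [cj Bj]; rewrite -(odd_double_half i) -(odd_double_half j).
rewrite (IH _ _ ci cj); congr (nat_of_bool _ + _)%N.
by move: Bi Bj; case: (odd i); case: (odd j).
Qed.

Lemma cell_decides k j i : (i < k)%N -> cell k j `<=` B i \/ cell k j `<=` ~` B i.
Proof.
elim: k j => // k IH j; rewrite ltnS leq_eqVlt => /orP[/eqP ->|/IH ik] /=.
  by case: ifP => _; [left|right] => x [].
by case: (ik j./2) => h; [left|right] => x [/h].
Qed.

Lemma measure_cells (R : realType) (d' : measure_display) (T : measurableType d')
    (phi : T -> X) (mphi : measurable_fun setT phi)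
    (mu : {finite_measure set T -> \bar R}) (A : set T) k : measurable A ->
  mu A = \sum_(j < 2 ^ k) mu (A `&` phi @^-1` cell k j).
Proof.
move=> mA; pose F j := A `&` phi @^-1` cell k j.
have mF j : measurable (F j).
  apply: measurableI => //; rewrite -[X in measurable X]setTI.
  by apply: mphi => //; exact: measurable_cell.
have tF : trivIset setT F.
  by move=> i j _ _ [x [[_ ci] [_ cj]]]; exact: cell_inj ci cj.
rewrite -(measure_bigsetU mu mF tF).
congr (mu _); rewrite -bigcup_mkord; apply/seteqP; split => [x Ax|x [j _ []]//].
by have [j jk cj] := cell_cover k (phi x); exists j.
Qed.

(** Inside each cell as much mass as possible is coupled, namely the minimum of the two masses, by a
    multiple of the product measure. For the union [A] of the cells where [mu] exceeds [nu], the
    uncoupled part of [mu] has mass [mu - nu] on the preimage of [A]. Pairs in a common cell of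
    level [k] are not separated by [B i] for [i < k]. *)
Lemma cell_coupling (R : realType) (d' : measure_display) (T : measurableType d')
    (phi : T -> X) (mphi : measurable_fun setT phi)
    (mu nu : {finite_measure set T -> \bar R}) (k : nat) :
  exists (q : {measure set (T * T) -> \bar R}) (A : set X),
  [/\ measurable A,
    forall C, measurable C -> q (C `*` setT) <= mu C,
    forall C, measurable C -> q (setT `*` C) <= nu C,
    mu setT + nu (phi @^-1` A) <= q setT + mu (phi @^-1` A) &
    forall i, (i < k)%N -> q ((phi @^-1` B i) `*` (phi @^-1` ~` B i)) = 0 /\
      q ((phi @^-1` ~` B i) `*` (phi @^-1` B i)) = 0].
Proof.
have mpre C : measurable C -> measurable (phi @^-1` C).
  by move=> mC; rewrite -[X in measurable X]setTI; exact: mphi.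
pose D j := phi @^-1` cell k j.
have mD j : measurable (D j) by exact/mpre/measurable_cell.
have mDD j : measurable (D j `*` D j) by exact: measurableX.
pose a j : R := fine (mu (D j)); pose b j : R := fine (nu (D j)).
have muD j : mu (D j) = (a j)%:E by rewrite fineK// fin_num_measure.
have nuD j : nu (D j) = (b j)%:E by rewrite fineK// fin_num_measure.
have a0 j : (0 <= a j)%R by exact: fine_ge0.
have b0 j : (0 <= b j)%R by exact: fine_ge0.
(* If one of the masses vanishes, the quotient is 0, which is the right weight because the minimum
   is then 0. *)
pose w j : R := (Num.min (a j) (b j) / (a j * b j))%R.
have w0 j : (0 <= w j)%R by rewrite divr_ge0 ?mulr_ge0// le_min a0 b0.
pose q : {measure set (T * T) -> \bar R} :=
  msum (fun j => mscale (NngNum (w0 j)) (mrestr (mu \x nu) (mDD j))) (2 ^ k).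
have qE C E : measurable C -> measurable E ->
    q (C `*` E) = \sum_(j < 2 ^ k) (w j)%:E * (mu (C `&` D j) * nu (E `&` D j)).
  move=> mC mE; rewrite /q /= /msum; apply: eq_bigr => j _.
  rewrite [LHS](_ : _ = (w j)%:E * (mu \x nu) ((C `*` E) `&` (D j `*` D j)))//.
  by rewrite -setXI product_measure1E//; exact: measurableI.
have wab j : (w j * (a j * b j) = Num.min (a j) (b j))%R.
  rewrite /w; have [->|aN0] := eqVneq (a j) 0%R.
    by rewrite mul0r mulr0 min_l.
  have [->|bN0] := eqVneq (b j) 0%R; first by rewrite !mulr0 min_r.
  by rewrite divfK// mulf_neq0.
have wb j : (w j * b j <= 1)%R.
  rewrite /w; have [->|aN0] := eqVneq (a j) 0%R; first by rewrite mul0r invr0 mulr0 mul0r.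
  have [->|bN0] := eqVneq (b j) 0%R; first by rewrite !mulr0.
  by rewrite invfM mulrA divfK// ler_pdivrMr ?lt0r ?aN0 ?a0// mul1r ge_min lexx.
have wa j : (w j * a j <= 1)%R.
  rewrite /w; have [->|aN0] := eqVneq (a j) 0%R; first by rewrite !mulr0.
  have [->|bN0] := eqVneq (b j) 0%R; first by rewrite mulr0 invr0 mulr0 mul0r.
  rewrite (mulrC (a j)) invfM mulrA divfK// ler_pdivrMr ?lt0r ?bN0 ?b0// mul1r.
  by rewrite ge_min lexx orbT.
pose A := \bigcup_(j in [set j | (j < 2 ^ k)%N /\ (b j < a j)%R]) cell k j.
have mA : measurable A by apply: bigcup_measurable => j _; exact: measurable_cell.
have AD j : (j < 2 ^ k)%N -> phi @^-1` A `&` D j = if (b j < a j)%R then D j else set0.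
  move=> jk; apply/seteqP; split => [x [[i [ik ba]] ci cj]|x].
    by rewrite (cell_inj cj ci) ba.
  by case: ifP => // ba Dx; split => //; exists j.
have cells (m : {finite_measure set T -> \bar R}) C : measurable C ->
    m C = \sum_(j < 2 ^ k) m (C `&` D j) by exact: measure_cells.
exists q, A; split => //.
- move=> C mC; rewrite qE// (cells mu C mC); apply: lee_sum => j _.
  rewrite setTI nuD.
  have mCD : measurable (C `&` D j) by exact: measurableI.
  have : 0 <= mu (C `&` D j) by [].
  have [c ->] := finite_measure_EFin mu mCD.
  rewrite -!EFinM !lee_fin => c0; by rewrite mulrCA ler_piMr// wb.
- move=> C mC; rewrite qE// (cells nu C mC); apply: lee_sum => j _.
  rewrite setTI muD.
  have mCD : measurable (C `&` D j) by exact: measurableI.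
  have : 0 <= nu (C `&` D j) by [].
  have [c ->] := finite_measure_EFin nu mCD.
  by rewrite -!EFinM !lee_fin => c0; rewrite mulrA ler_piMl// wa.
- rewrite -setXTT qE// (cells mu _ measurableT).
  rewrite (cells nu _ (mpre _ mA)) (cells mu _ (mpre _ mA)).
  rewrite -!big_split /=; apply: lee_sum => j _.
  (* In a single cell the claim reads [a + b <= b + a] if [b < a], and [a <= a] otherwise. *)
  rewrite !setTI AD//; case: ifPn => [ba|];
    rewrite ?measure0 ?muD ?nuD -?EFinM ?adde0 wab.
    by rewrite -!EFinD lee_fin min_r ?(ltW ba)// addrC.
  by rewrite -leNgt lee_fin => /min_l ->.
- move=> i ik; have zero C E : measurable C -> measurable E ->
      (forall j, C `&` cell k j = set0 \/ E `&` cell k j = set0) ->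
      q ((phi @^-1` C) `*` (phi @^-1` E)) = 0.
    move=> mC mE CE; rewrite qE; [|exact: mpre..].
    rewrite big1// => j _; 
    have pD F : phi @^-1` F `&` D j = phi @^-1` (F `&` cell k j) by [].
    rewrite !pD.
    by case: (CE j) => ->; rewrite preimage_set0 measure0 ?mul0e ?mule0.
  have mBC := measurableC (mB i).
  have cellB j : B i `&` cell k j = set0 \/ ~` B i `&` cell k j = set0.
    have [h|h] := @cell_decides k j i ik; [right|left]; rewrite -subset0 => x [Bx].
      by move=> /h.
    by move=> /h.
  split; apply: zero => // j.
  by case: (cellB j); auto.
Qed.

End cells.

(** * Limits of couplings *)

(** The image ultrafilter has a cluster point in the compact segment, and an ultrafilter converges
    to each of its cluster points. *)
Lemma ultra_bounded_cvg (R : realType) (I : Type) (U : set_system I)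
    (u : I -> R) (a b : R) :
  UltraFilter U -> (forall i, a <= u i <= b)%R -> cvg (u @ U).
Proof.
move=> UU uab.
have [|l [_ cl]] := @segment_compact R a b (u @ U) _.
  by apply: (@filterE _ U _ (u @^-1` `[a, b])) => i; rewrite /= in_itv; exact: uab.
apply/cvg_ex; exists l => N Nl.
have [//|UN] := in_ultra_setVsetC (u @^-1` N) UU.
by have [x []] := cl (~` N) N UN Nl.
Qed.

Section measure_of_outer.
Context (R : realType) (d : measure_display) (T : measurableType d).
Variable m : {outer_measure set T -> \bar R}.
Hypothesis mcara : forall A, measurable A -> m.-caratheodory A.

Definition measure_of_outer of
  (forall A : set T, measurable A -> m.-caratheodory A) : set T -> \bar R := m.

Let moo := measure_of_outer mcara.

Let moo0 : moo set0 = 0. Proof. exact: outer_measure0. Qed.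

Let moo_ge0 A : 0 <= moo A. Proof. exact: outer_measure_ge0. Qed.

Let moo_sigma_additive : semi_sigma_additive moo.
Proof.
move=> F mF tF mUF; apply: (@caratheodory_measure_sigma_additive _ _ m F) => //.
  by move=> n; exact: mcara.
exact: mcara.
Qed.

HB.instance Definition _ := isMeasure.Build _ _ _ (measure_of_outer mcara)
  moo0 moo_ge0 moo_sigma_additive.

End measure_of_outer.

(** Cutting every set of a cover of [W] along [S] yields covers of both parts of [W], at no greater
    total cost. *)
Lemma mu_ext_caratheodory (R : realType) (d : measure_display)
    (T : measurableType d) (m : set T -> \bar R) (S : set T) :
  (forall W, 0 <= m W) -> measurable S ->
  (forall W, measurable W -> m (W `&` S) + m (W `&` ~` S) <= m W) ->
  forall W, mu_ext m (W `&` S) + mu_ext m (W `&` ~` S) <= mu_ext m W.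
Proof.
move=> m0 mS split_m W; apply: le_ereal_inf_tmp => _ [F [mF WF] <-].
have ge0 (V : set T) : forall n, true -> 0 <= m (F n `&` V) by [].
apply: (@le_trans _ _ (\sum_(n <oo) m (F n `&` S) + \sum_(n <oo) m (F n `&` ~` S))).
  apply: leeD; apply: ereal_inf_lbound.
    exists (fun n => F n `&` S) => //; split => [n|x [/WF[n _ Fn] Sx]].
      exact: measurableI.
    by exists n.
  exists (fun n => F n `&` ~` S) => //; split => [n|x [/WF[n _ Fn] Sx]].
    by apply: measurableI => //; exact: measurableC.
  by exists n.
rewrite -nneseriesD//; apply: lee_nneseries => // n _.
  by rewrite adde_ge0.
exact: split_m.
Qed.

Section outer_measure_of_cover.
Context (R : realType) (d : measure_display) (T : measurableType d).
Variable m : set T -> \bar R.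
Hypotheses (m0 : m set0 = 0) (m_ge0 : forall A, 0 <= m A).

Definition outer_measure_of_cover of m set0 = 0 & (forall A, 0 <= m A) :
  set T -> \bar R := mu_ext m.

HB.instance Definition _ := isOuterMeasure.Build R T
  (outer_measure_of_cover m0 m_ge0) (mu_ext0 m0 m_ge0) (mu_ext_ge0 m_ge0)
  (@le_mu_ext _ _ _ m) (mu_ext_sigma_subadditive m_ge0).

End outer_measure_of_cover.

Section limit_coupling.
Context (R : realType) (d : measure_display) (T : measurableType d).
Hypothesis sT : standard_borel R T.
Variables (mu nu : {finite_measure set T -> \bar R}).
(* The error sets [E] and [E'] come from tightness and outer regularity; the
   rest of the square is covered by finitely many of the rectangles, by
   compactness. *)
Lemma finite_rectangle_subcover (A B : nat -> set T) (e : R) :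
  (0 < e)%R -> (forall n, measurable (A n)) -> (forall n, measurable (B n)) ->
  setT `<=` \bigcup_n (A n `*` B n) ->
  exists (N : nat) (E E' : set T),
    [/\ measurable E, measurable E', mu E <= e%:E, nu E' <= e%:E &
     setT `<=` E `*` setT `|` setT `*` E' `|` \bigcup_(n < N) (A n `*` B n)].
Proof.
move=> e0 mA mB AB; have [X [sX [f [g [fK gK mf mg]]]]] := sT.
have e20 : (0 < e / 2)%R by rewrite divr_gt0.
(* Off the small set [E], points stay in a compact set and every [C n] coincides with the preimage
   of an open set. One half of [e] pays for tightness, the other for outer regularity. *)
have half (m : {finite_measure set T -> \bar R}) (C : nat -> set T) :
    (forall n, measurable (C n)) ->
  exists (K : set X) (U : nat -> set X) (E : set T), [/\ compact K,
    forall n, open (U n) /\ C n `<=` f @^-1` U n, measurable E, m E <= e%:E &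
    (forall x, ~ E x -> K (f x)) /\
    (forall n x, ~ E x -> U n (f x) -> C n x)].
  move=> mC; have [K [cK clK] Ke] := tight_finite_measure mf m sX e20.
  have /choice[U UP] n : exists U, [/\ open U, g @^-1` C n `<=` U &
      m (f @^-1` (U `\` g @^-1` C n)) <= (e / 2 / (2 ^ n.+1)%:R)%:E].
    apply: (outer_regular_finite_measure mf m (mg _ (mC n))).
    by rewrite divr_gt0// ltr0n expn_gt0.
  have mK : measurable (f @^-1` ~` K).
    by apply: mf; apply: sub_sigma_algebra; exact: closed_openC.
  have mG n : measurable (f @^-1` (U n `\` g @^-1` C n)).
    apply: (@measurableD _ _ (f @^-1` U n)); apply: mf; last exact: mg.
    by apply: sub_sigma_algebra; have [] := UP n.
  have mUG : measurable (\bigcup_n f @^-1` (U n `\` g @^-1` C n)).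
    exact: bigcupT_measurable.
  exists K, U, ((f @^-1` ~` K) `|` \bigcup_n f @^-1` (U n `\` g @^-1` C n)).
  split => //.
  - move=> n; have [oU CU _] := UP n; split => // x Cx; apply: CU.
    by rewrite /= fK.
  - exact: measurableU.
  - apply: le_trans (measureU2 _ mK mUG) _; rewrite [e]splitr EFinD; apply: leeD => //.
    apply: measure_bigcup_le_geometric => //; first exact: ltW.
    by move=> n; have [] := UP n.
  - split => [x|n x] Ex.
      by apply: contrapT => Kx; apply: Ex; left.
    move=> Ux; apply: contrapT => Cx; apply: Ex; right; exists n => //; split => //.
    by rewrite /= fK.
have [K1 [U1 [E1 [cK1 U1P mE1 E1e [E1K E1U]]]]] := half mu A mA.
have [K2 [U2 [E2 [cK2 U2P mE2 E2e [E2K E2U]]]]] := half nu B mB.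
have : @compact (X * X)%type (K1 `*` K2) by exact: compact_setX.
(* The property is monotone in [N], so the near-covering form of compactness provides one [N] for
   all points. *)
move=> /compact_near_coveringP/(_ nat \oo
  (fun N z => exists2 n, (n < N)%N & (U1 n `*` U2 n) z)).
case.
- move=> [x y] _; have [n _ [/= An Bn]] := AB (g x, g y) I.
  exists (U1 n `*` U2 n, [set N | (n < N)%N]); last by case=> z N [/= Uz nN]; exists n.
  split; last by exists n.+1.
  exists (U1 n, U2 n) => //; split; apply: open_nbhs_nbhs; split => /=.
  - exact: (U1P n).1.
  - by rewrite -(gK x); exact: (U1P n).2.
  - exact: (U2P n).1.
  - by rewrite -(gK y); exact: (U2P n).2.
move=> N _ /(_ N (leqnn _)) DP; exists N, E1, E2; split => // -[x y] _.
have [E1x|E1x] := pselect (E1 x); first by left; left.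
have [E2y|E2y] := pselect (E2 y); first by left; right.
right; have [n nN [/= U1x U2y]] := DP (f x, f y) (conj (E1K _ E1x) (E2K _ E2y)).
by exists n => //; split; [exact: E1U U1x|exact: E2U U2y].
Qed.

Variables (q : nat -> {measure set (T * T) -> \bar R}) (c : R).
Hypothesis q_fst : forall k A, measurable A -> q k (A `*` setT) <= mu A.
Hypothesis q_snd : forall k A, measurable A -> q k (setT `*` A) <= nu A.
Hypothesis q_mass : forall k, c%:E <= q k setT.
Variables (U : set_system nat) (UU : UltraFilter U) (oU : \oo `<=` U).

Let qlim (W : set (T * T)) : R := lim (fine (q k W) @[k --> U]).

Let qleT k W : measurable W -> q k W <= mu setT.
Proof.
move=> mW; apply: (@le_trans _ _ (q k setT)).
  by apply: le_measure; [exact: mem_set|exact/mem_set/measurableT|exact: subsetT].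
by rewrite -setXTT q_fst.
Qed.

Let qfin k W : measurable W -> q k W \is a fin_num.
Proof.
move=> mW; rewrite ge0_fin_numE//; apply: le_lt_trans (qleT k mW) _.
by rewrite -ge0_fin_numE// fin_num_measure.
Qed.

Let qlim_cvg W : measurable W -> fine (q k W) @[k --> U] --> qlim W.
Proof.
move=> mW; apply: (@ultra_bounded_cvg _ _ _ _ 0 (fine (mu setT))) => // k.
by rewrite fine_ge0//= fine_le ?qfin ?fin_num_measure// qleT.
Qed.

Let qlim_le W (a : R) : measurable W -> (forall k, q k W <= a%:E) -> (qlim W <= a)%R.
Proof.
move=> mW qa; apply: (ler_cvg_to (qlim_cvg mW) (cvg_cst a)).
by apply: filterE => k; rewrite -lee_fin fineK ?qfin.
Qed.

Let qlim_ge0 W : measurable W -> (0 <= qlim W)%R.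
Proof.
move=> mW; apply: (ler_cvg_to (cvg_cst _) (qlim_cvg mW)).
by apply: filterE => k; rewrite fine_ge0.
Qed.

Let qlim_split W S : measurable W -> measurable S ->
  qlim W = (qlim (W `&` S) + qlim (W `&` ~` S))%R.
Proof.
move=> mW mS.
have mWS : measurable (W `&` S) by exact: measurableI.
have mWCS : measurable (W `&` ~` S) by apply: measurableI => //; exact: measurableC.
apply: (@cvg_unique _ _ (fine (q k W) @[k --> U])) => //; first exact: qlim_cvg.
apply: cvg_trans (cvgD (qlim_cvg mWS) (qlim_cvg mWCS)).
apply: near_eq_cvg; apply: filterE => k /=.
by rewrite (measureDI (q k) mW mS) setDE fineD ?qfin// addrC.
Qed.

(* Outside the rectangles the value is irrelevant: with [+oo], only covers by
   rectangles matter in [mu_ext]. *)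
Let rect (W : set (T * T)) : \bar R :=
  if pselect (exists2 A, measurable A & exists2 B, measurable B & W = A `*` B)
  then (qlim W)%:E else +oo.

Let rectE A B : measurable A -> measurable B -> rect (A `*` B) = (qlim (A `*` B))%:E.
Proof.
by move=> mA mB; rewrite /rect; case: pselect => // -[]; exists A => //; exists B.
Qed.

Let rectP W : rect W = +oo \/
  exists2 A, measurable A & exists2 B, measurable B & W = A `*` B.
Proof. by rewrite /rect; case: pselect => h; [right|left]. Qed.

Let rect_ge0 W : 0 <= rect W.
Proof.
have [->//|[A mA [B mB ->]]] := rectP W.
by rewrite rectE// lee_fin qlim_ge0//; exact: measurableX.
Qed.

Let rect0 : rect set0 = 0.
Proof.
have := rectE (@measurable0 _ T) (@measurable0 _ T).
rewrite setX0 => ->; congr EFin.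
apply: (@cvg_unique _ _ (fine (q k set0) @[k --> U])) => //; first exact: qlim_cvg.
by apply: cvg_near_cst; apply: filterE => k; rewrite measure0.
Qed.

(** The set to split along is a strip: what a strip leaves of a rectangle is again a rectangle, so
    [rect] stays finite and finite additivity of [qlim] applies. *)
Let rect_split A B W : measurable A -> measurable B -> A = setT \/ B = setT ->
  rect (W `&` A `*` B) + rect (W `&` ~` (A `*` B)) <= rect W.
Proof.
move=> mA mB AB; have [->|[A' mA' [B' mB' ->]]] := rectP W; first by rewrite leey.
 have mCA := measurableC mA; have mCB := measurableC mB.
have -> : (A' `*` B') `&` (A `*` B) = (A' `&` A) `*` (B' `&` B) by rewrite setXI.
have mAB : measurable (A `*` B) by exact: measurableX.
rewrite (rectE mA' mB') (rectE (measurableI _ _ mA' mA) (measurableI _ _ mB' mB)) setXI.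
rewrite (qlim_split (measurableX mA' mB') mAB) EFinD leeD2l//.
case: AB => ->.
  rewrite (_ : (A' `*` B') `&` ~` _ = A' `*` (B' `&` ~` B)) ?rectE//.
    exact: measurableI.
  by apply/seteqP; split => -[x y] /=; tauto.
rewrite (_ : (A' `*` B') `&` ~` _ = (A' `&` ~` A) `*` B') ?rectE//.
  exact: measurableI.
by apply/seteqP; split => -[x y] /=; tauto.
Qed.

(** This is where countable additivity is gained. Up to two strips of small measure, finitely many
    of the rectangles cover the square, so the mass bound for [q k] becomes a finite inequality with
    an error uniform in [k], which passes to the limit. *)
Let rect_cover (F : nat -> set (T * T)) : setT `<=` \bigcup_n F n ->
  c%:E <= \sum_(n <oo) rect (F n).
Proof.
move=> TF.
have [[n Fn]|Foo] := pselect (exists n, rect (F n) = +oo).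
  rewrite (eseries_pinfty _ _ Fn) ?leey// => k _.
  by rewrite -ltNye (lt_le_trans _ (rect_ge0 _)).
have /choice[AB ABP] n : exists AB : set T * set T,
    [/\ measurable AB.1, measurable AB.2 & F n = AB.1 `*` AB.2].
  have [Fn|[A mA [B mB FE]]] := rectP (F n); first by case: Foo; exists n.
  by exists (A, B).
have mF n : measurable (F n).
  by have [mA mB ->] := ABP n; exact: measurableX.
have rF n : rect (F n) = (qlim (F n))%:E.
  by have [mA mB FE] := ABP n; rewrite FE rectE.
apply/lee_addgt0Pr => e e0.
have e20 : (0 < e / 2)%R by rewrite divr_gt0.
have [||x _|N [E [E' [mE mE' Ee E'e TE]]]] := @finite_rectangle_subcover
  (fun n => (AB n).1) (fun n => (AB n).2) _ e20.
- by move=> n; have [] := ABP n.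
- by move=> n; have [] := ABP n.
- by have [n _ Fn] := TF x I; exists n => //; have [_ _ <-] := ABP n.
have qN k : c%:E <= \sum_(n < N) q k (F n) + e%:E.
  apply: le_trans (q_mass k) _.
  have mET : measurable (E `*` [set: T]) by exact: measurableX.
  have mTE' : measurable ([set: T] `*` E') by exact: measurableX.
  have mUF : measurable (\bigcup_(n < N) F n) by exact: bigcup_measurable.
  have mEE : measurable (E `*` setT `|` setT `*` E') by exact: measurableU.
  apply: (@le_trans _ _ (q k (E `*` setT `|` setT `*` E' `|` \bigcup_(n < N) F n))).
    apply: le_measure; [exact/mem_set/measurableT|exact/mem_set/measurableU|].
    move=> x /TE[|[n nN Fn]]; [by left|right; exists n => //].
    by have [_ _ ->] := ABP n.
  apply: le_trans (measureU2 _ mEE mUF) _; rewrite addeC; apply: leeD.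
    apply: content_subadditive => //.
    by rewrite bigcup_mkord.
  apply: le_trans (measureU2 _ mET mTE') _; rewrite [e]splitr EFinD; apply: leeD.
    exact: le_trans (q_fst _ mE) Ee.
  exact: le_trans (q_snd _ mE') E'e.
have cN : (c <= \sum_(n < N) qlim (F n) + e)%R.
  apply: (@ler_cvg_to _ U _ _ (cst c) (fun k => \sum_(n < N) fine (q k (F n)) + e)%R).
  + exact: cvg_cst.
  + apply: cvgD; last exact: cvg_cst.
    apply: cvg_big => [|n _]; [exact: add_continuous|exact: qlim_cvg].
  + apply: filterE => k; rewrite -lee_fin EFinD -sumEFin.
    by under eq_bigr do rewrite fineK ?qfin//; exact: qN.
apply: (@le_trans _ _ (\sum_(0 <= n < N) rect (F n) + e%:E)).
  by rewrite big_mkord; under eq_bigr do rewrite rF; rewrite sumEFin -EFinD lee_fin.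
by rewrite leeD2r//; apply: nneseries_lim_ge => n _.
Qed.

Let outer : {outer_measure set (T * T) -> \bar R} :=
  outer_measure_of_cover rect0 rect_ge0.

(** Strips satisfy the splitting condition by [rect_split]; a rectangle is the intersection of two
    strips, and rectangles generate the product sigma-algebra. *)
Let outer_caratheodory W : measurable W -> outer.-caratheodory W.
Proof.
have half A B : measurable A -> measurable B -> A = setT \/ B = setT ->
    outer.-caratheodory (A `*` B).
  move=> mA mB AB; apply: le_caratheodory_measurable => Z.
  apply: mu_ext_caratheodory => [||V mV]; first exact: rect_ge0.
    exact: measurableX.
  exact: rect_split.
rewrite measurable_prod_measurableType; apply: smallest_sub W.
  split.
  - exact: caratheodory_measurable_set0.
  - by move=> A cA; rewrite setTD; exact: caratheodory_measurable_setC.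
  - by move=> F cF; exact: caratheodory_measurable_bigcup.
move=> _ [A mA [B mB <-]].
rewrite -(setIT A) -(setTI B) setXI; apply: caratheodory_measurable_setI.
  by apply: half => //; right.
by apply: half => //; left.
Qed.

Let outer_le_rect A B : measurable A -> measurable B ->
  outer (A `*` B) <= (qlim (A `*` B))%:E.
Proof.
move=> mA mB; rewrite -rectE//.
pose F n := if n is 0%N then A `*` B else set0.
have -> : rect (A `*` B) = \sum_(n <oo) rect (F n).
  rewrite nneseries_recl//.
  by rewrite /= eseries_cond eseries0 ?adde0// => -[|]//= k _ _; rewrite rect0.
apply: ereal_inf_lbound; exists F => //; split.
  by move=> [|n] /=; [exact: measurableX|exact: measurable0].
by move=> x ABx; exists 0%N.
Qed.

(** The upper bounds come from covering a rectangle by itself, the lower bound on the total mass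
    from [rect_cover]. *)
Lemma ultralimit_coupling : exists r : {measure set (T * T) -> \bar R},
  [/\ forall A, measurable A -> r (A `*` setT) <= mu A,
    forall A, measurable A -> r (setT `*` A) <= nu A,
    c%:E <= r setT &
    forall A B N, measurable A -> measurable B ->
      (forall k, (N < k)%N -> q k (A `*` B) = 0) -> r (A `*` B) = 0].
Proof.
exists (measure_of_outer outer_caratheodory); split => [A mA|A mA||A B N mA mB qAB].
- apply: le_trans (outer_le_rect mA measurableT) _.
  have [a muA] := finite_measure_EFin mu mA.
  rewrite muA lee_fin; apply: qlim_le; first exact: measurableX.
  by move=> k; rewrite -muA q_fst.
- apply: le_trans (outer_le_rect measurableT mA) _.
  have [a nuA] := finite_measure_EFin nu mA.
  rewrite nuA lee_fin; apply: qlim_le; first exact: measurableX.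
  by move=> k; rewrite -nuA q_snd.
- apply: le_ereal_inf_tmp => _ [F [mF TF] <-]; exact: rect_cover.
- apply/eqP; rewrite eq_le measure_ge0 andbT.
  apply: le_trans (outer_le_rect mA mB) _; rewrite lee_fin le_eqVlt; apply/orP; left.
  apply/eqP; apply: (@cvg_unique _ _ (fine (q k (A `*` B)) @[k --> U])) => //.
    by apply: qlim_cvg; exact: measurableX.
  (* [U] refines [\oo], so it contains the tail of indices above [N], where the values are 0. *)
  apply: cvg_near_cst; apply: oU; exists N.+1 => // k /qAB -> //.
Qed.

End limit_coupling.

Lemma limit_coupling (R : realType) (d : measure_display) (T : measurableType d)
    (mu nu : {finite_measure set T -> \bar R})
    (q : nat -> {measure set (T * T) -> \bar R}) (c : R) :
  standard_borel R T ->
  (forall k A, measurable A -> q k (A `*` setT) <= mu A) ->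
  (forall k A, measurable A -> q k (setT `*` A) <= nu A) ->
  (forall k, c%:E <= q k setT) ->
  exists r : {measure set (T * T) -> \bar R},
  [/\ forall A, measurable A -> r (A `*` setT) <= mu A,
    forall A, measurable A -> r (setT `*` A) <= nu A,
    c%:E <= r setT &
    forall A B N, measurable A -> measurable B ->
      (forall k, (N < k)%N -> q k (A `*` B) = 0) -> r (A `*` B) = 0].
Proof.
move=> sT q1 q2 qc.
have [U [UU oU]] := @ultraFilterLemma nat \oo _.
exact: (ultralimit_coupling sT q1 q2 qc UU oU).
Qed.

(** * Smooth equivalence relations *)

Lemma finite_pushforward (R : realType) (d d' : measure_display)
    (T : measurableType d) (X : measurableType d') (phi : T -> X)
    (mu : {finite_measure set T -> \bar R}) : measurable_fun setT phi ->
  exists m : {finite_measure set X -> \bar R}, forall C, m C = mu (phi @^-1` C).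
Proof.
move=> mphi.
have fin : pushforward mu phi setT < +oo.
  by rewrite /pushforward preimage_setT -ge0_fin_numE// fin_num_measure.
by unshelve eexists (finite_measure_of fin).
Qed.

Lemma measure_pushforward (R : realType) (d d' : measure_display)
    (T : measurableType d) (X : measurableType d') (phi : T -> X)
    (mu : {measure set T -> \bar R}) : measurable_fun setT phi ->
  exists m : {measure set X -> \bar R}, forall C, m C = mu (phi @^-1` C).
Proof. by move=> mphi; unshelve eexists (pushforward mu phi). Qed.

(** The two strips over an invariant set agree on [E]. For a coupling this is weak duality; for a
    measure living on [E] it says that both marginals agree on [A]. *)
Lemma measure_invariant_setX_le (R : realType) (d : measure_display)
    (T : measurableType d) (r : {measure set (T * T) -> \bar R})
    (E : set (T * T)) (A : set T) :
  measurable E -> measurable A ->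
  (forall x y, E (x, y) -> (A x <-> A y)) ->
  r (A `*` setT) <= r (setT `*` A) + r (~` E) /\
  r (setT `*` A) <= r (A `*` setT) + r (~` E).
Proof.
move=> mE mA EA; have mCE := measurableC mE.
have mAT : measurable (A `*` @setT T) by exact: measurableX.
have mTA : measurable (@setT T `*` A) by exact: measurableX.
split; apply: le_trans (measureU2 _ _ _) => //; apply: le_measure;
  rewrite ?inE//; try exact: measurableU.
- move=> [x y] [/= Ax _]; have [Exy|] := pselect (E (x, y)); last by right.
  by left; split => //=; exact/(EA x y Exy).
- move=> [x y] [/= _ Ay]; have [Exy|] := pselect (E (x, y)); last by right.
  by left; split => //=; exact/(EA x y Exy).
Qed.

(** Distinct values of [phi] are separated by some [B n]. Writing the complement of [E] as a
    countable union of rectangles serves both its measurability and the proof that it is a null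
    set. *)
Lemma smooth_sections (R : realType) (d : measure_display)
    (T : measurableType d) (E : set (T * T)) : smooth R E ->
  exists (d' : measure_display) (X : measurableType d') (phi : T -> X)
    (B : nat -> set X),
  [/\ measurable_fun setT phi, forall n, measurable (B n),
    forall w w', E (w, w') <-> phi w = phi w' &
    ~` E = \bigcup_n ((phi @^-1` B n) `*` (phi @^-1` ~` B n) `|`
                      (phi @^-1` ~` B n) `*` (phi @^-1` B n))].
Proof.
move=> [d' [X [phi [sX mphi Ephi]]]].
have [B [mB Bsep]] := standard_borel_separating sX.
exists d', X, phi, B; split => //; apply/seteqP; split => -[x y] /=.
  move=> Exy; apply: contrapT => h; apply/Exy/Ephi/Bsep => n.
  by split => Bn; apply: contrapT => NBn; apply: h; exists n => //; [left|right].
by move=> [n _ [[/= Bx By]|[/= Bx By]]] /Ephi xy; move: Bx By; rewrite xy.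
Qed.

Lemma measurable_smooth (R : realType) (d : measure_display)
    (T : measurableType d) (E : set (T * T)) : smooth R E -> measurable E.
Proof.
move=> /smooth_sections[d' [X [phi [B [mphi mB _ CE]]]]].
rewrite -(setCK E) CE; apply: measurableC; apply: bigcupT_measurable => n.
have mpre C : measurable C -> measurable (phi @^-1` C).
  by move=> mC; rewrite -[X in measurable X]setTI; exact: mphi.
have mCB := measurableC (mB n).
by apply: measurableU; apply: measurableX; exact: mpre.
Qed.

(** The last clause certifies that the mass of [r] is maximal: the rests live on complementary
    invariant sets, so nothing of them can be matched along [E]. *)
Definition separated_residuals (R : realType) (d : measure_display)
    (T : measurableType d) (E : set (T * T))
    (mu nu : {finite_measure set T -> \bar R})
    (r : {measure set (T * T) -> \bar R})
    (mu' nu' : {finite_measure set T -> \bar R}) (A : set T) :=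
  [/\ forall C, measurable C -> mu C = r (C `*` setT) + mu' C,
    forall C, measurable C -> nu C = r (setT `*` C) + nu' C,
    r (~` E) = 0,
    measurable A /\ forall w w', E (w, w') -> (A w <-> A w') &
    mu' (~` A) = 0 /\ nu' A = 0].

Lemma smooth_residual (R : realType) (d : measure_display)
    (T : measurableType d) (E : set (T * T))
    (mu nu : {finite_measure set T -> \bar R}) :
  standard_borel R T -> smooth R E ->
  exists (r : {measure set (T * T) -> \bar R})
    (mu' nu' : {finite_measure set T -> \bar R}) (A : set T),
    separated_residuals E mu nu r mu' nu' A.
Proof.
move=> sT sE; have mE := measurable_smooth sE.
have [d' [X [phi [B [mphi mB Ephi CE]]]]] := smooth_sections sE.
have mpre C : measurable C -> measurable (phi @^-1` C).
  by move=> mC; rewrite -[X in measurable X]setTI; exact: mphi.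
have [muX muXE] := finite_pushforward mu mphi.
have [nuX nuXE] := finite_pushforward nu mphi.
have [S mS maxS] := maximal_difference_set muX nuX.
pose A := phi @^-1` S; have mA : measurable A by exact: mpre.
have [mT muT] := finite_measure_EFin mu measurableT.
have [a muA] := finite_measure_EFin mu mA.
have [b nuA] := finite_measure_EFin nu mA.
have /choice[q qP] k := cell_coupling mB mphi mu nu k.
(* The set [S] does at least as well as the union of cells [Ak], so this lower bound is the same for
   all [k]. *)
have qc k : (mT - (a - b))%:E <= q k setT.
  have [Ak [mAk _ _ qk _]] := qP k.
  have := maxS _ mAk; rewrite !muXE !nuXE -/A muA nuA.
  move: qk; rewrite muT.
  have [ak ->] := finite_measure_EFin mu (mpre _ mAk).
  have [bk ->] := finite_measure_EFin nu (mpre _ mAk).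
  have : 0 <= q k setT by [].
  case: (q k setT) => [t _|_ _ _|//]; last by rewrite leey.
  by rewrite -!EFinD !lee_fin => h1 h2; lra.
have q1 k C : measurable C -> q k (C `*` setT) <= mu C.
  by have [Ak [_ h _ _ _]] := qP k; exact: h.
have q2 k C : measurable C -> q k (setT `*` C) <= nu C.
  by have [Ak [_ _ h _ _]] := qP k; exact: h.
have [r [r1 r2 rc r0]] := limit_coupling sT q1 q2 qc.
(* Each of the countably many rectangles making up the complement of [E] is null for [q k] as soon
   as [k > n], hence null for [r]. *)
have rE : r (~` E) = 0.
  have mR n C D : measurable C -> measurable D ->
      measurable ((phi @^-1` C) `*` (phi @^-1` D)).
    by move=> mC mD; apply: measurableX; exact: mpre.
  have null C D n : measurable C -> measurable D ->
      (forall k, (n < k)%N -> q k ((phi @^-1` C) `*` (phi @^-1` D)) = 0) ->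
      r.-negligible ((phi @^-1` C) `*` (phi @^-1` D)).
    move=> mC mD qCD; apply/negligibleP; first exact: mR.
    by apply: r0 qCD; exact: mpre.
  apply/negligibleP; first exact: measurableC.
  rewrite CE; apply: negligible_bigcup => n.
  have mCB := measurableC (mB n).
  apply: negligibleU; apply: (null _ _ n) => // k nk.
    by have [Ak [_ _ _ _ h]] := qP k; exact: (h n nk).1.
  by have [Ak [_ _ _ _ h]] := qP k; exact: (h n nk).2.
have mCE : measurable (~` E) by exact: measurableC.
have [n1 n1E] := measure_pushforward r (@measurable_fst _ _ T T).
have [n2 n2E] := measure_pushforward r (@measurable_snd _ _ T T).
have [mu' mu'E] : exists mu' : {finite_measure set T -> \bar R},
    forall C, measurable C -> mu C = n1 C + mu' C.
  by apply: finite_measure_difference => C mC; rewrite n1E -setXT r1.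
have [nu' nu'E] : exists nu' : {finite_measure set T -> \bar R},
    forall C, measurable C -> nu C = n2 C + nu' C.
  by apply: finite_measure_difference => C mC; rewrite n2E -setTX r2.
have inv w w' : E (w, w') -> (A w <-> A w') by move=> /Ephi; rewrite /A /preimage/= => ->.
exists r, mu', nu', A; split => //.
- by move=> C mC; rewrite mu'E// n1E setXT.
- by move=> C mC; rewrite nu'E// n2E setTX.
have mCA := measurableC mA.
have rA : r (A `*` setT) = r (setT `*` A).
  have [] := measure_invariant_setX_le r mE mA inv.
  by rewrite rE !adde0 => h1 h2; apply/eqP; rewrite eq_le h1.
move: muT muA nuA rc; rewrite !mu'E// nu'E// !n1E n2E -!setXT -setTX rA.
have -> : mu' setT = mu' A + mu' (~` A).
  by rewrite -measureU// ?setICr// setUv.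
have : 0 <= mu' (~` A) by [].
have : 0 <= nu' A by [].
have [u ->] := finite_measure_EFin mu' mA.
have [v ->] := finite_measure_EFin mu' mCA.
have [t ->] := finite_measure_EFin nu' mA.
rewrite setXTT; case: (r setT) => [m| |]//; case: (r (setT `*` A)) => [x| |]//.
rewrite !lee_fin -!EFinD => t0 v0 [<-] [<-] [<-] h.
have v00 : v = 0%R by lra.
have t00 : t = 0%R by lra.
by rewrite v00 t00.
Qed.

(** * Increasing unions *)

Section probability_of.
Context (R : realType) (d : measure_display) (T : measurableType d).
Variables (mu : {measure set T -> \bar R}) (mu1 : mu setT = 1).

Definition probability_of of mu setT = 1 : set T -> \bar R := mu.

HB.instance Definition _ := Measure.on (probability_of mu1).

HB.instance Definition _ :=
  @Measure_isProbability.Build _ _ _ (probability_of mu1) mu1.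

End probability_of.

Lemma weak_duality (R : realType) (d : measure_display)
    (T : measurableType d) (P P' : probability T R) (Q : probability (T * T)%type R)
    (E : set (T * T)) (A : set T) :
  measurable E -> couplings P P' Q -> invariant_sets E A ->
  `|P A - P' A| <= 1 - Q E.
Proof.
move=> mE cQ [mA EA]; rewrite -probability_setC//.
have [] : P A <= P' A + Q (~` E) /\ P' A <= P A + Q (~` E).
  have [<- <-] := cQ A mA; rewrite -setXT -setTX.
  exact: measure_invariant_setX_le.
have [a ->] := finite_measure_EFin P mA.
have [b ->] := finite_measure_EFin P' mA.
have [e ->] := finite_measure_EFin Q (measurableC mE).
rewrite -EFinN -!EFinD abse_EFin !lee_fin ler_norml => h1 h2.
by apply/andP; split; lra.
Qed.

Lemma bigcup_smooth_residual (R : realType) (d : measure_display) (T : measurableType d)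
    (E_ : nat -> set (T * T)) (mu nu : {finite_measure set T -> \bar R}) :
  standard_borel R T -> (forall n, smooth R (E_ n)) ->
  (forall n, E_ n `<=` E_ n.+1) ->
  exists (r : {measure set (T * T) -> \bar R})
    (mu' nu' : {finite_measure set T -> \bar R}) (A : set T),
  separated_residuals (\bigcup_n E_ n) mu nu r mu' nu' A.
Proof.
move=> sT sE incE; pose M := {finite_measure set T -> \bar R}.
(* The choice is made for all indices and all pairs of measures at once, so that the step can be
   iterated. *)
have /choice[F FP] (x : nat * (M * M)) :
    exists o : {measure set (T * T) -> \bar R} * (M * M) * set T,
      separated_residuals (E_ x.1) x.2.1 x.2.2 o.1.1 o.1.2.1 o.1.2.2 o.2.
  have [r [mu' [nu' [A h]]]] := smooth_residual x.2.1 x.2.2 sT (sE x.1).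
  by exists (r, (mu', nu'), A).
pose st := fix st n := if n is n'.+1 then (F (n', st n')).1.2 else (mu, nu).
pose q n := (F (n, st n)).1.1; pose A n := (F (n, st n)).2.
have stP n : separated_residuals (E_ n) (st n).1 (st n).2 (q n)
    (st n.+1).1 (st n.+1).2 (A n).
  exact: FP (n, st n).
have mE n := measurable_smooth (sE n).
have le_E k n : (k <= n)%N -> E_ k `<=` E_ n.
  by move=> kn; apply/subsetPset; apply: (homo_leq (r := fun A B => A <= B)%O) kn => //;
    [exact: le_trans|move=> i; exact/subsetPset/incE].
have sum1 n C : measurable C -> mu C = \sum_(i < n) q i (C `*` setT) + (st n).1 C.
  move=> mC; elim: n => [|n ->]; first by rewrite big_ord0 add0e.
  by rewrite big_ord_recr /= -addeA; congr (_ + _); have [-> //] := stP n.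
have sum2 n C : measurable C -> nu C = \sum_(i < n) q i (setT `*` C) + (st n).2 C.
  move=> mC; elim: n => [|n ->]; first by rewrite big_ord0 add0e.
  by rewrite big_ord_recr /= -addeA; congr (_ + _); have [_ -> //] := stP n.
pose Q : {measure set (T * T) -> \bar R} := mseries q 0.
have Qge n W : \sum_(i < n) q i W <= Q W.
  by rewrite -(big_mkord predT (fun i => q i W)); exact: nneseries_lim_ge.
have Qle W a : (forall n, \sum_(i < n) q i W <= a) -> Q W <= a.
  move=> h; apply: lime_le; first exact: is_cvg_nneseries.
  by apply: nearW => n; rewrite big_mkord.
have [n1 n1E] := measure_pushforward Q (@measurable_fst _ _ T T).
have [n2 n2E] := measure_pushforward Q (@measurable_snd _ _ T T).
have {}n1E C : n1 C = Q (C `*` setT) by rewrite n1E setXT.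
have {}n2E C : n2 C = Q (setT `*` C) by rewrite n2E setTX.
(* Stated for a general [V], to serve both marginals. The final rest is below the [k]-th one because
   [Q] is above its partial sums. *)
have residual (m : M) (n : {measure set T -> \bar R}) (V : set T -> set (T * T))
    (s : nat -> M) :
    (forall C, n C = Q (V C)) ->
    (forall k C, measurable C -> m C = \sum_(i < k) q i (V C) + s k C) ->
  exists m' : M, (forall C, measurable C -> m C = Q (V C) + m' C) /\
     forall k C, measurable C -> m' C <= s k C.
  move=> nE sE'; have [|m' m'E] := @finite_measure_difference _ _ _ m n.
    move=> C mC; rewrite nE; apply: Qle => k; rewrite (sE' k C mC).
    by rewrite leeDl.
  exists m'; split => [C mC|k C mC]; first by rewrite m'E// nE.
  have := m'E C mC; have := sE' k C mC; have := Qge k (V C); rewrite nE.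
  have [c ->] := finite_measure_EFin m mC.
  have [a ->] := finite_measure_EFin m' mC.
  have [b ->] := finite_measure_EFin (s k) mC.
  case: (\sum_(i < k) _) => [x| |]//; case: (Q (V C)) => [y| |]//.
  by rewrite -!EFinD !lee_fin => xy [->] [h]; lra.
have [mu' [muE mu'le]] := residual mu n1 (fun C => C `*` setT)
  (fun k => (st k).1) n1E sum1.
have [nu' [nuE nu'le]] := residual nu n2 (fun C => setT `*` C)
  (fun k => (st k).2) n2E sum2.
have mA n : measurable (A n) by have [_ _ _ [] ] := stP n.
have mCA n : measurable (~` A n) by exact: measurableC.
have mu'A n : mu' (~` A n) = 0.
  apply/eqP; rewrite eq_le measure_ge0 andbT.
  by have [_ _ _ _ [<- _]] := stP n; exact: mu'le.
have nu'A n : nu' (A n) = 0.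
  apply/eqP; rewrite eq_le measure_ge0 andbT.
  by have [_ _ _ _ [_ <-]] := stP n; exact: nu'le.
pose L := \bigcup_n \bigcap_(k >= n) A k.
have mL : measurable L.
  by apply: bigcupT_measurable => n; apply: bigcap_measurable => //; exists n => /=.
exists Q, mu', nu', L; split => //.
- apply/eqP; rewrite eq_le measure_ge0 andbT; apply: Qle => n.
  rewrite big1// => i _; apply/eqP; rewrite eq_le measure_ge0 andbT.
  have [_ _ <- _ _] := stP i.
  apply: le_measure.
  + by apply/mem_set/measurableC; exact: bigcupT_measurable.
  + exact/mem_set/measurableC.
  + by apply: subsetC => x Ex; exists i.
- split => // w w' [k _ Ek].
  have half x y : (forall n, (k <= n)%N -> A n x -> A n y) -> L x -> L y.
    (* Only the [A n] with [n >= k] are known to be invariant under [E_ k]; a lower limit may skip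
       the others. *)
    move=> xy [N _ Nx]; exists (maxn N k) => // n /=; rewrite geq_max => /andP[Nn kn].
    by apply: xy => //; exact: Nx.
  by split; apply: half => n kn; have [_ _ _ [_ /(_ w w' (le_E _ _ kn _ Ek))[]]] := stP n.
- split.
    apply/negligibleP; first exact: measurableC.
    apply: (@negligibleS _ _ _ _ (\bigcup_n ~` A n)).
      move=> x Lx; apply: contrapT => Ax; apply: Lx; exists 0%N => // n _.
      by apply: contrapT => Anx; apply: Ax; exists n.
    by apply: negligible_bigcup => n; apply/(negligibleP _ (mCA n))/mu'A.
  apply/negligibleP => //.
  apply: (@negligibleS _ _ _ _ (\bigcup_n A n)).
    by move=> x [n _ /(_ n)Anx]; exists n => //; exact: (Anx (leqnn n)).
  by apply: negligible_bigcup => n; apply/(negligibleP _ (mA n))/nu'A.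
Qed.

(** The two rests have the same mass [m], so their product divided by [m] has them as marginals. *)
Lemma complete_coupling (R : realType) (d : measure_display)
    (T : measurableType d) (P P' : probability T R)
    (r : {measure set (T * T) -> \bar R})
    (rho rho' : {finite_measure set T -> \bar R}) :
  (forall C, measurable C -> P C = r (C `*` setT) + rho C) ->
  (forall C, measurable C -> P' C = r (setT `*` C) + rho' C) ->
  exists2 Q, couplings P P' Q & forall W, r W <= Q W.
Proof.
move=> PE P'E.
have [m mE] := finite_measure_EFin rho measurableT.
have m0 : (0 <= m)%R by rewrite -lee_fin -mE.
have rhoT : rho' setT = m%:E.
  have := P'E _ measurableT; have := PE _ measurableT.
  rewrite !probability_setT mE setXTT.
  have [m' ->] := finite_measure_EFin rho' measurableT.
  by case: (r setT) => [x| |]// -[->] [] /addrI ->.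
have mi0 : (0 <= m^-1)%R by rewrite invr_ge0.
pose Q : {measure set (T * T) -> \bar R} :=
  measure_add r (mscale (NngNum mi0) (rho \x rho')).
have QE W : Q W = r W + m^-1%:E * (rho \x rho') W by exact: measure_addE.
have prodE C D : measurable C -> measurable D ->
    (rho \x rho') (C `*` D) = rho C * rho' D by exact: product_measure1E.
have scale (n : {finite_measure set T -> \bar R}) C : n setT = m%:E ->
    measurable C -> m^-1%:E * (n C * m%:E) = n C.
  move=> nT mC; have : n C <= n setT by apply: le_measure; rewrite ?inE.
  have : 0 <= n C by [].
  rewrite nT; have [a ->] := finite_measure_EFin n mC.
  rewrite !lee_fin -!EFinM => a0 am; congr EFin.
  (* For [m = 0] the inverse is 0 as well, and the rests are zero measures. *)
  have [m00|mN0] := eqVneq m 0%R; last by rewrite mulrCA mulVf// mulr1.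
  by apply/eqP; rewrite m00 mulr0 mulr0 eq_sym eq_le a0 -m00 am.
have Q1 C : measurable C -> Q (C `*` setT) = P C.
  by move=> mC; rewrite QE prodE// rhoT scale// -PE.
have Q2 C : measurable C -> Q (setT `*` C) = P' C.
  by move=> mC; rewrite QE prodE// mE (muleC m%:E) scale// -P'E.
have QT : Q setT = 1 by rewrite -setXTT Q1// probability_setT.
exists (probability_of QT) => [C mC|W].
  by split; [rewrite -setXT; exact: Q1|rewrite -setTX; exact: Q2].
by rewrite -[leRHS]/(Q W) QE leeDl// mule_ge0.
Qed.

Theorem corollary3p18 (R : realType) (d : measure_display)
    (T : measurableType d) (E : set (T * T)) (E_ : nat -> set (T * T)) :
  standard_borel R T ->
  equivalence E ->
  (forall n, equivalence (E_ n)) ->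
  (forall n, smooth R (E_ n)) ->
  (forall n, E_ n `<=` E_ n.+1) ->
  E = \bigcup_n E_ n ->
  strongly_dualizable R E.
Proof.
move=> sT _ _ sE incE EE.
have mE : measurable E.
  by rewrite EE; apply: bigcupT_measurable => n; exact: measurable_smooth.
split => // P P'.
have [r [rho [rho' [A]]]] := bigcup_smooth_residual P P' sT sE incE.
rewrite -EE => -[PE P'E rCE [mA EA] [rhoA rho'A]].
have {}PE C : measurable C -> P C = r (C `*` setT) + rho C by exact: PE.
have {}P'E C : measurable C -> P' C = r (setT `*` C) + rho' C by exact: P'E.
have [Q cQ rQ] := complete_coupling PE P'E.
have iA : invariant_sets E A by split.
(* The measure [r] lives on [E], so [1 = r E + rho A]. Its marginals agree on [A] and [rho' A = 0],
   so [P A - P' A = rho A]. Finally [r E <= Q E]. *)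
have QA : 1 - Q E <= `|P A - P' A|.
  have mCE := measurableC mE; have mCA := measurableC mA.
  have rT : r setT = r E.
    have -> : r setT = r E + r (~` E).
      by rewrite -measureU// ?setICr// setUv.
    by rewrite rCE adde0.
  have rA : r (A `*` setT) = r (setT `*` A).
    have [] := measure_invariant_setX_le r mE mA EA.
    by rewrite rCE !adde0 => h1 h2; apply/eqP; rewrite eq_le h1.
  have := rQ E; have := PE _ measurableT.
  have -> : rho setT = rho A.
    have -> : rho setT = rho A + rho (~` A).
      by rewrite -measureU// ?setICr// setUv.
    by rewrite rhoA adde0.
  rewrite probability_setT setXTT rT PE// P'E// rho'A adde0 rA.
  have : P' A \is a fin_num by exact: fin_num_measure.
  rewrite P'E// rho'A adde0.
  have [a ->] := finite_measure_EFin rho mA.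
  have [e ->] := finite_measure_EFin Q mE.
  case: (r (setT `*` A)) => [x| |]// _; case: (r E) => [y| |]// -[->].
  rewrite -!EFinN -!EFinD abse_EFin !lee_fin => ye.
  by rewrite (le_trans _ (ler_norm _))//; lra.
have dual (Q' : probability (T * T)%type R) (B : set T) :
    couplings P P' Q' -> invariant_sets E B -> `|P B - P' B| <= 1 - Q' E.
  exact: weak_duality.
(* By weak duality and [QA], the set [A] and the coupling [Q] attain the common value. *)
exists `|P A - P' A|; split; split.
- by exists A.
- by move=> _ [B iB <-]; exact: le_trans (dual _ _ cQ iB) QA.
- by exists Q => //; apply/eqP; rewrite eq_le QA dual.
- by move=> _ [Q' cQ' <-]; exact: dual.
Qed.
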